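(* Let $W$ be a widely-connected separable metric space, and let $\gamma W$ be a compactification of $W$. Then $\gamma W$ is indecomposable if and only if $\gamma W$ is irreducible.
   Context: A connected topological space $W$ is widely-connected if every non-degenerate connected subset of $W$ (one with more than one point) is dense in $W$. A compactification of $W$ is a compact Hausdorff space (not necessarily metrizable) in which $W$ is densely embedded. A continuum is a connected compact Hausdorff space; it is indecomposable if it cannot be written as the union of any two of its proper subcontinua. A composant of a continuum is the union of all its proper subcontinua that contain a given point. A continuum is irreducible if it has more than one composant, that is, if there are two points between which it is irreducible, meaning that no proper closed connected subset contains both points. *)

(* Defs.v *)
From mathcomp Require Import all_boot all_order all_algebra.
From mathcomp Require Import all_classical all_reals all_analysis.

Set Implicit Arguments.
Unset Strict Implicit.
Unset Printing Implicit Defensive.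

Local Open Scope classical_set_scope.

Definition nondegenerate (T : Type) (A : set T) : Prop :=
  exists x y, [/\ A x, A y & x <> y].

Definition separable_space (T : topologicalType) : Prop :=
  exists2 D : set T, countable D & dense D.

Definition widely_connected (W : topologicalType) : Prop :=
  connected [set: W] /\
  forall A : set W, connected A -> nondegenerate A -> dense A.

Definition topological_embedding (S T : topologicalType) (f : S -> T) : Prop :=
  [/\ injective f, continuous f &
      forall U : set S, open U -> exists2 V : set T, open V & f @^-1` V = U].

Definition compactification (W K : topologicalType) (e : W -> K) : Prop :=
  [/\ hausdorff_space K, compact [set: K],
      topological_embedding e & dense (range e)].

(* [A] is a continuum in the subspace topology, provided that the ambient space
   is Hausdorff. Nonemptiness is explicit because [connected set0] holds. *)
Definition continuum (T : topologicalType) (A : set T) : Prop :=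
  [/\ A !=set0, connected A & compact A].

Definition proper_subcontinuum (T : topologicalType) (A : set T) : Prop :=
  continuum A /\ A <> [set: T].

Definition indecomposable (T : topologicalType) : Prop :=
  continuum [set: T] /\
  forall A B : set T, proper_subcontinuum A -> proper_subcontinuum B ->
    A `|` B <> [set: T].

Definition composant (T : topologicalType) (p : T) : set T :=
  \bigcup_(A in [set A : set T | proper_subcontinuum A /\ A p]) A.

Definition irreducible_between (T : topologicalType) (p q : T) : Prop :=
  forall C : set T, closed C -> connected C -> C p -> C q -> C = [set: T].

(* If a Hausdorff space has more than one point, then [p] and [q] are
   necessarily distinct, since otherwise [[set p]] would be a proper closed
   connected set containing both. The equivalence with having more than one
   composant is [irreducible_composants]. *)
Definition irreducible (T : topologicalType) : Prop :=
  continuum [set: T] /\ exists p q : T, irreducible_between p q.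

Section Composants.
Variable T : topologicalType.
Hypotheses (hT : hausdorff_space T) (cT : continuum [set: T]).

Lemma composantP (p q : T) :
  irreducible_between p q <-> ~ composant p q.
Proof.
have [_ _ kT] := cT; split.
  by move=> pq [C /= [[[_ conC kC] +] Cp] Cq]; apply; apply: pq => //;
    exact: compact_closed.
move=> npq C clC conC Cp Cq; apply: contrapT => CT; apply: npq.
exists C => //=; split=> //; split=> //; split=> //; first by exists p.
exact: (subclosed_compact clC kT).
Qed.

Lemma irreducible_composants : nondegenerate [set: T] ->
  irreducible T <-> exists p q : T, composant p <> composant q.
Proof.
move=> [a [b [_ _ ab]]].
have composantxx (x : T) : composant x x.
  exists [set x] => //=; split=> //; split.
    by split; [exists x|exact: connected1|exact: compact_set1].
  move=> xT; apply: ab.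
  have : [set x] a by rewrite xT.
  have : [set x] b by rewrite xT.
  by move=> /= -> ->.
split=> [[_ [p [q /composantP pq]]]|[p [q pq]]].
  by exists p, q => E; apply: pq; rewrite E.
split=> //; apply: contrapT => nirr; apply: pq.
have full (x : T) : composant x = [set: T].
  apply/seteqP; split=> // y _; apply: contrapT => /composantP xy.
  by apply: nirr; exists x, y.
by rewrite !full.
Qed.

End Composants.

(* Main.v *)
Require Import Defs.
From mathcomp Require Import all_boot all_order all_algebra.
From mathcomp Require Import all_classical all_reals all_analysis.

Set Implicit Arguments.
Unset Strict Implicit.
Unset Printing Implicit Defensive.

Import Order.TTheory GRing.Theory Num.Theory.

Local Open Scope classical_set_scope.

(** The two implications rest on different hypotheses.

    If [K] is indecomposable, each of its proper closed connected subsets has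
    empty interior ([indecomposable_interior0]). For metrizable [K] it is
    classical that a composant is a countable union of such sets, so that
    Baire's theorem provides a second composant. Metrizability serves there
    only to give a countable base, and a countable pi-base is enough: a proper
    subcontinuum through [p] avoids some member [V] of the pi-base, hence lies
    in the component of [p] in [~` V] ([indecomposable_irreducible]). A
    compactification of a separable metric space, metrizable or not, inherits
    a countable pi-base from that space ([compactification_pi_base]).

    Conversely, let [K] be irreducible between [p] and [q] and be the union of
    two proper subcontinua. Each contains exactly one of [p] and [q].
    Complements of subcontinua through [p] are connected
    ([irreducible_setC_connected]), so the two pieces can be replaced by
    [B], a regular closed continuum containing [q], and
    [A = closure (~` B)], which contains [p]. The point is that the trace of
    [A] on [W] is connected ([connected_trace]): if it were split into [P] and
    [Q] with [p] in the closure of [P], then [closure P `|` B] would be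
    a continuum joining [p] to [q], hence all of [K], leaving no room for [Q].
    But this trace is not dense, because [A] is not [K], and it has more than
    one point, because [A] has nonempty interior and [K] is connected. Hence
    [W] is not widely connected. *)

(** * Separated sets and complements of continua *)

Lemma setC_nonempty (T : Type) (A : set T) : A <> [set: T] -> ~` A !=set0.
Proof.
by move=> AT; apply/set0P/eqP => A0; apply: AT; rewrite -[A]setCK A0 setC0.
Qed.

Lemma closure_min (T : topologicalType) (A B : set T) :
  closed B -> A `<=` B -> closure A `<=` B.
Proof. by move=> clB AB; apply: subset_trans clB; exact: closureS. Qed.

Section Connectedness.
Variable T : topologicalType.
Implicit Types A B C U V M N : set T.

(** A connected part [C] of [A] lies in one piece of any separation of [A],
    so that only the other piece has to be shown empty. This removes the
    symmetry between the pieces. *)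
Lemma connected_anchor A C : connected C -> C `<=` A ->
  (forall M N, A = M `|` N -> separated M N -> C `<=` N -> M = set0) ->
  connected A.
Proof.
move=> cC CA anchor; apply/connectedP => E [E0 AE sE].
have CE : C `<=` E false `|` E true by rewrite -AE.
have [CF|CT] := connected_subset sE CE cC.
- have /set0P/eqP[] := E0 true.
  by apply: (anchor _ (E false)) => //; [rewrite setUC|rewrite separatedC].
- have /set0P/eqP[] := E0 false.
  exact: (anchor _ (E true)).
Qed.

Lemma connected_setT_separated M N : connected [set: T] ->
  separated M N -> M `|` N = [set: T] -> M = set0 \/ N = set0.
Proof.
move=> cT sMN MN.
have TMN : [set: T] `<=` M `|` N by rewrite MN.
have disj := separated_disjoint sMN.
have [TM|TN] := connected_subset sMN TMN cT; [right|left];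
  rewrite -subset0 => x Hx; rewrite -disj; split=> //.
- exact: TM.
- exact: TN.
Qed.

Lemma separatedUr M N V : separated M N -> separated M V ->
  separated M (N `|` V).
Proof.
by move=> [MN1 MN2] [MV1 MV2]; split; rewrite ?closureU setIUr;
  rewrite ?MN1 ?MN2 ?MV1 ?MV2 setU0.
Qed.

Lemma separatedS A B M N : M `<=` A -> N `<=` B ->
  separated A B -> separated M N.
Proof.
move=> MA NB [AB1 AB2]; split; rewrite -subset0.
- rewrite -AB1; apply: setISS => //; exact: closureS.
- rewrite -AB2; apply: setISS => //; exact: closureS.
Qed.

(** A piece [M] of a separation of [C `|` U] that misses [C] lies in [U], so
    it is separated from [V] as well; it would then split off from the whole
    space. *)
Lemma connected_setU_side C U V : connected [set: T] -> connected C ->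
  C !=set0 -> ~` C = U `|` V -> separated U V -> connected (C `|` U).
Proof.
move=> cT cC [c Cc] CUV sUV; apply: (@connected_anchor _ C) => // M N CU sMN CN.
have MU : M `<=` U.
  move=> x Mx; have [Cx|//] : (C `|` U) x by rewrite CU; left.
  have : (M `&` N) x by split=> //; exact: CN.
  by rewrite separated_disjoint.
have sMNV : separated M (N `|` V).
  by apply: separatedUr => //; exact: separatedS sUV.
have MNV : M `|` (N `|` V) = [set: T].
  by rewrite setUA -CU -setUA -CUV setUv.
have [//|NV0] := connected_setT_separated cT sMNV MNV.
have : (N `|` V) c by left; exact: CN.
by rewrite NV0.
Qed.

Lemma closed_setU_side C U V : closed C ->
  ~` C = U `|` V -> separated U V -> closed (C `|` U).
Proof.
move=> clC CUV [UV _]; rewrite closure_id eqEsubset.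
split; first exact: subset_closure.
rewrite closureU -((closure_id C).1 clC) => x [Cx|clUx]; first by left.
apply: contrapT => /not_orP[nCx nUx].
have [//|Vx] : (U `|` V) x by rewrite -CUV.
by have : set0 x by rewrite -UV.
Qed.

Lemma setU_side_proper C U V : V !=set0 ->
  ~` C = U `|` V -> separated U V -> C `|` U <> [set: T].
Proof.
move=> [v Vv] CUV sUV CUT.
have nCv : (~` C) v by rewrite CUV; right.
have [//|Uv] : (C `|` U) v by rewrite CUT.
have : (U `&` V) v by [].
by rewrite separated_disjoint.
Qed.

Lemma disconnected_setC C : connected [set: T] -> closed C -> connected C ->
  C !=set0 -> ~ connected (~` C) ->
  exists U V, ~` C = U `|` V /\
    forall A, A = C `|` U \/ A = C `|` V ->
      [/\ closed A, connected A & A <> [set: T]].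
Proof.
move=> cT clC cC C0 /connectedPn[E [E0 CE sE]].
exists (E false), (E true); split=> // A.
have CE' : ~` C = E true `|` E false by rewrite setUC.
have sE' : separated (E true) (E false) by rewrite separatedC.
by case=> ->; split; [exact: closed_setU_side sE|exact: connected_setU_side sE|
  exact: setU_side_proper sE|exact: closed_setU_side sE'|
  exact: connected_setU_side sE'|exact: setU_side_proper sE'].
Qed.

(** If [~` C] splits into [U] and [V], both [C `|` U] and [C `|` V] are proper
    continua through [p], and one of them contains [q]. *)
Lemma irreducible_setC_connected C (p q : T) : connected [set: T] ->
  irreducible_between p q -> closed C -> connected C -> C p ->
  connected (~` C).
Proof.
move=> cT irr clC cC Cp; apply: contrapT => dC.
have C0 : C !=set0 by exists p.
have [U [V [CUV sides]]] := disconnected_setC cT clC cC C0 dC.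
have [clU cU UT] := sides _ (or_introl erefl).
have [clV cV VT] := sides _ (or_intror erefl).
have [Cq|nCq] := pselect (C q).
  by apply: UT; apply: irr => //; left.
have [Uq|Vq] : (U `|` V) q by rewrite -CUV.
- by apply: UT; apply: irr => //; [left|right].
- by apply: VT; apply: irr => //; [left|right].
Qed.

(** Suppose that [C] has an interior point. If [~` C] is connected, then [C] and
    [closure (~` C)] decompose the space; if it splits into [U] and [V], then
    [C `|` U] and [C `|` V] do. *)
Lemma indecomposable_interior0 C : hausdorff_space T -> indecomposable T ->
  closed C -> connected C -> C <> [set: T] -> C° = set0.
Proof.
move=> hT [[_ cT kT] indec] clC cC CT.
apply: contrapT => /eqP/set0P[c iCc].
have Cc : C c by exact: interior_subset.
have C0 : C !=set0 by exists c.
have pS A : A !=set0 -> closed A -> connected A -> A <> [set: T] ->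
    proper_subcontinuum A.
  by move=> A0 clA cA AT; split=> //; split=> //; exact: subclosed_compact kT _.
have [cnC|dC] := pselect (connected (~` C)).
  apply: (indec C (closure (~` C))).
  - exact: pS.
  - apply: pS.
    + have [x Cx] := setC_nonempty CT.
      by exists x; exact: subset_closure.
    + exact: closed_closure.
    + exact: connected_closure.
    + rewrite closure_setC => CT'.
      have : (~` C°) c by rewrite CT'.
      exact.
  - rewrite -subTset => x _; have [|nCx] := pselect (C x); [by left|right].
    exact: subset_closure.
have [U [V [CUV sides]]] := disconnected_setC cT clC cC C0 dC.
have [clU cU UT] := sides _ (or_introl erefl).
have [clV cV VT] := sides _ (or_intror erefl).
apply: (indec (C `|` U) (C `|` V)).
- by apply: pS => //; exists c; left.
- by apply: pS => //; exists c; left.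
- by rewrite setUACA setUid -CUV setUv.
Qed.

End Connectedness.

Lemma separated_preimage (S T : topologicalType) (f : S -> T) (M N : set T) :
  continuous f -> separated M N -> separated (f @^-1` M) (f @^-1` N).
Proof.
move=> cf [MN1 MN2].
have clf A : closure (f @^-1` A) `<=` f @^-1` closure A.
  apply: closure_min; last by move=> x Ax /=; exact: subset_closure.
  by move/continuous_closedP: cf; apply; exact: closed_closure.
split; rewrite -subset0 => x [].
- by move=> /clf Mx Nx; rewrite -[set0 x]/(set0 (f x)) -MN1.
- by move=> Mx /clf Nx; rewrite -[set0 x]/(set0 (f x)) -MN2.
Qed.

(** * A Baire theorem and the existence of composants *)

Section Baire.
Variable T : topologicalType.

(** Regularity yields nonempty open sets [O n] with
    [closure (O n.+1)] inside [O n] and disjoint from the [n]-th closed set;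
    a cluster point of this decreasing sequence avoids all of them. *)
Lemma compact_hausdorff_baire (I : set (set T)) : hausdorff_space T ->
  compact [set: T] -> [set: T] !=set0 -> countable I ->
  (forall F, I F -> closed F /\ F° = set0) ->
  exists x, forall F, I F -> ~ F x.
Proof.
move=> hT kT [t _] /pfcard_geP[->|[F]] HI; first by exists t.
have IF n : I (F n) by exact: funS.
pose NO := {O : set T | open O /\ O !=set0}.
have step (i : nat * NO) : exists O' : NO,
    closure (sval O') `<=` sval i.2 `\` F i.1.
  move: i => [n [U [oU U0]]] /=; have [clF F0] := HI _ (IF n).
  have [x [Ux nFx]] : U `\` F n !=set0.
    apply/set0P/eqP; rewrite setD_eq0 => UF.
    have [y Uy] := U0; have : (F n)° y.
      by apply: (filterS UF); exact: open_nbhs_nbhs.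
    by rewrite F0.
  have nUF : nbhs x (U `\` F n).
    apply: open_nbhs_nbhs; split=> //; rewrite setDE; apply: openI => //.
    exact: closed_openC.
  have [B nB BU] := compact_regular hT kT (@filterT _ _ _) nUF.
  have pB : open B° /\ B° !=set0 by split; [exact: open_interior|exists x].
  exists (exist _ B° pB) => /=; apply: subset_trans BU.
  by apply: closureS; exact: interior_subset.
have [g gP] := choice step.
have pT : open [set: T] /\ [set: T] !=set0 by split; [exact: openT|exists t].
pose O := fix O n : NO := if n is m.+1 then g (m, O m) else exist _ setT pT.
have Oclos n : closure (sval (O n.+1)) `<=` sval (O n) `\` F n.
  exact: (gP (n, O n)).
have Odecr m n : m <= n -> sval (O n) `<=` sval (O m).
  elim: n => [|n IH]; first by rewrite leqn0 => /eqP ->.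
  rewrite leq_eqVlt => /predU1P[->//|/IH]; apply: subset_trans.
  by move=> x /subset_closure /Oclos[].
pose G : set_system T := filter_from setT (fun n => sval (O n)).
have PG : ProperFilter G.
  apply: filter_from_proper; last by move=> n _; have [_] := svalP (O n).
  apply: filter_from_filter; first by exists 0.
  move=> i j _ _; exists (maxn i j) => // x Ox.
  by split; apply: Odecr Ox; rewrite ?leq_maxl ?leq_maxr.
have [x [_ Gx]] := kT G PG (@filterT _ _ _).
exists x => A IA; have [n _ <-] := @surj _ _ _ _ F A IA.
have : closure (sval (O n.+1)) x.
  by move=> B nB; apply: Gx => //; exists n.+1.
by case/Oclos.
Qed.

End Baire.

(** Unlike a base, a pi-base is only required to refine nonempty open sets, not
    neighborhoods of each point; this weaker property passes to
    compactifications, which need not be second countable. *)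
Definition countable_pi_base (T : topologicalType) : Prop :=
  exists2 B : set (set T), countable B &
    (forall V, B V -> open V /\ V !=set0) /\
    (forall O, open O -> O !=set0 -> exists2 V, B V & V `<=` O).

(** The composant of [p] is covered by the components of [p] in the complements
    of the members of the pi-base: these are countably many closed sets with
    empty interior, and any [q] outside all of them is a second endpoint. *)
Lemma indecomposable_irreducible (T : topologicalType) :
  hausdorff_space T -> countable_pi_base T ->
  indecomposable T -> irreducible T.
Proof.
move=> hT [B cB [Bne Bpi]] indec.
have [contT _] := indec; split=> //; have [[p _] cT kT] := contT.
pose I := (fun V => connected_component (~` V) p) @` B.
have [q qI] : exists q, forall F, I F -> ~ F q.
  apply: compact_hausdorff_baire => //; first by exists p.
    exact: (sub_countable (card_image_le _ _)).
  move=> _ [V BV <-]; have [oV [v Vv]] := Bne _ BV.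
  have clV : closed (connected_component (~` V) p).
    exact/component_closed/open_closedC.
  split=> //; apply: indecomposable_interior0 => //.
    exact: component_connected.
  move=> CT; apply: (@connected_component_sub _ (~` V) p v) => //.
  by rewrite CT.
exists p, q => C clC cC Cp Cq; apply: contrapT => CT.
have [V BV VC] := Bpi _ (closed_openC clC) (setC_nonempty CT).
apply: (qI (connected_component (~` V) p)); first by exists V.
by exists C => //; split=> //; rewrite -[C]setCK; exact: subsetC.
Qed.

(** * Pi-bases of separable metric spaces and of their compactifications *)

Lemma separable_pi_base (R : realType) (W : metricType R) :
  separable_space W -> countable_pi_base W.
Proof.
move=> [D cD dD].
pose B := (fun i : W * nat => (ball i.1 (i.2.+1%:R^-1 : R))°) @`
  (D `*` [set: nat]).
exists B.
  exact: (sub_countable (card_image_le _ _) (countableX cD (countableP _))).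
have cball (x : W) n : (ball x (n.+1%:R^-1 : R))° x.
  by apply: nbhsx_ballx; rewrite invr_gt0.
split=> [_ [[d n] _ <-]|O oO [x Ox]].
  by split; [exact: open_interior|exists d; exact: cball].
have /nbhs_ballP[r /= r0 rO] : nbhs x O by exact: open_nbhs_nbhs.
have r20 : (0 < r / 2)%R by rewrite divr_gt0.
have [n _ nr] := near_infty_natSinv_lt (PosNum r20).
have {}nr : (n.+1%:R^-1 < r / 2)%R by exact: nr (leqnn n).
have [||d [xd Dd]] := dD (ball x (n.+1%:R^-1 : R))°.
- by exists x; exact: cball.
- exact: open_interior.
exists (ball d (n.+1%:R^-1 : R))°; first by exists (d, n).
move=> y dy; apply: rO; rewrite [r]splitr.
by apply: (@ball_triangle _ _ d); apply: le_ball (ltW nr) _ _;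
  exact: interior_subset.
Qed.

Section Compactification.
Variables (W K : topologicalType) (e : W -> K).
Hypothesis eK : compactification e.

Lemma embedding_closure (P : set W) w : closure (e @` P) (e w) -> closure P w.
Proof.
case: eK => _ _ [_ _ eopen] _ cl U; rewrite nbhsE => -[U' [oU' U'w] U'U].
have [V oV VU'] := eopen _ oU'.
have [|_ [[x Px <-] Vx]] := cl V.
  by apply: open_nbhs_nbhs; split=> //; rewrite -[V _]/((e @^-1` V) w) VU'.
by exists x; split=> //; apply: U'U; rewrite -VU'.
Qed.

Lemma open_closure_trace (O : set K) : open O ->
  O `<=` closure (e @` (e @^-1` O)).
Proof.
case: eK => _ _ _ dK oO x Ox U; rewrite nbhsE => -[U' [oU' U'x] U'U].
have [||y [[Oy U'y] [w _ ew]]] := dK (O `&` U'); first by exists x.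
  exact: openI.
by exists y; split; [exists w => //=; rewrite ew|exact: U'U].
Qed.

(** Each open [U] of [W] has a largest open extension to [K],
    [~` closure (e @` (~` U))]. As [W] is dense, this extension is contained in
    [closure (e @` U)], so it lies in [O] as soon as [U] lies in an open set
    whose closure is contained in [O]. *)
Lemma compactification_pi_base : countable_pi_base W -> countable_pi_base K.
Proof.
have [hK kK [einj econt eopen] dK] := eK => -[B cB [Bne Bpi]].
pose ext (U : set W) := ~` closure (e @` (~` U)).
have oext U : open (ext U) by apply: closed_openC; exact: closed_closure.
exists (ext @` B); first exact: (sub_countable (card_image_le _ _)).
split=> [_ [U BU <-]|O oO [x Ox]].
  have [oU [u Uu]] := Bne _ BU; split=> //.
  exists (e u) => /embedding_closure.
  by rewrite closure_setC; apply; exact: open_nbhs_nbhs.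
have [P nP PO] := compact_regular hK kK (@filterT _ _ _)
  (open_nbhs_nbhs (conj oO Ox)).
have [||U BU UO] := Bpi (e @^-1` P°).
- by move/continuousP: econt; apply; exact: open_interior.
- have [||z [Pz [w _ ew]]] := dK P°; first by exists x.
    exact: open_interior.
  by exists w; rewrite /= ew.
exists (ext U); first by exists U.
move=> y Uy; apply: PO; have [//|nPy] := pselect (closure P y).
(* Outside [closure P], a point of the extension of [U] would have a
   neighborhood that misses both [U] and its complement in [W]. *)
have oN : open (ext U `&` ~` closure P).
  by apply: openI => //; apply: closed_openC; exact: closed_closure.
have [||z [[Uz nz] [w _ ew]]] := dK (ext U `&` ~` closure P).
- by exists y.
- by [].
exfalso; have [Uw|nUw] := pselect (U w).
  by apply: nz; apply: subset_closure; rewrite -ew;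
    apply: interior_subset; exact: UO.
by apply: Uz; apply: subset_closure; exists w.
Qed.

(** * Traces on the dense subspace *)

(** Suppose that [e @^-1` A], with [A = closure (~` B)], is separated into [P]
    and [Q]. A piece of [P] that stays away from [B] would be open and closed
    in [W], because points outside [A] are in [B]. Hence
    [closure (e @` P) `|` B] is connected. If [p] is in [closure (e @` P)],
    irreducibility makes this union the whole space, so that [~` B], and hence
    [A], lies in [closure (e @` P)], which misses [e @` Q]. *)
Lemma connected_trace (B : set K) (p q : K) : connected [set: W] ->
  irreducible_between p q -> closed B -> connected B -> B q ->
  closure (~` B) p -> connected (e @^-1` closure (~` B)).
Proof.
have [hK kK [einj econt eopen] dK] := eK.
move=> cW irr clB cB Bq Gp; set A := closure (~` B) in Gp *.
apply: contrapT => /connectedPn[E [E0 AE sE]].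
have GA : A `<=` closure (e @` (e @^-1` A)).
  apply: closure_min; first exact: closed_closure.
  apply: subset_trans (open_closure_trace _) _; first exact: closed_openC.
  by apply: closureS => _ [w Gw <-]; exists w => //; exact: subset_closure.
have trace_side P Q : P !=set0 -> Q !=set0 -> e @^-1` A = P `|` Q ->
    separated P Q -> ~ closure (e @` P) p.
  move=> [u Pu] [v Qv] APQ sPQ Pp.
  have PA : closure (e @` P) `<=` A.
    apply: closure_min; first exact: closed_closure.
    by move=> _ [w Pw <-]; have : (P `|` Q) w by [left]; rewrite -APQ.
  have cPB : connected (closure (e @` P) `|` B).
    apply: (@connected_anchor _ _ B) => // M N PBE sMN BN.
    have MP : M `<=` closure (e @` P).
      move=> x Mx; have [//|Bx] : (closure (e @` P) `|` B) x.
        by rewrite PBE; left.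
      have : (M `&` N) x by split=> //; exact: BN.
      by rewrite separated_disjoint.
    (* The trace of [M] avoids [B] and is separated from the rest of [W]. *)
    have eMP : e @^-1` M `<=` P.
      move=> w /MP ePw; have clPw := embedding_closure ePw.
      have [//|Qw] : (P `|` Q) w.
        by rewrite -APQ; exact: PA.
      by have : (closure P `&` Q) w by []; rewrite sPQ.1.
    have seMN := separated_preimage econt sMN.
    have seMQ : separated (e @^-1` M) (e @^-1` N `|` Q).
      by apply: separatedUr => //; exact: separatedS sPQ.
    have eMNQ : e @^-1` M `|` (e @^-1` N `|` Q) = [set: W].
      rewrite -subTset => w _.
      have [Aw|] := pselect ((e @^-1` A) w).
        move: Aw; rewrite APQ => -[Pw|Qw]; last by right; right.
        have : (closure (e @` P) `|` B) (e w).
          by left; apply: subset_closure; exists w.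
        by rewrite PBE => -[Mw|Nw]; [left|right; left].
      move=> nAw; right; left; apply: BN; apply: contrapT => nBw.
      by apply: nAw; exact: subset_closure.
    have [eM0|eNQ0] := connected_setT_separated cW seMQ eMNQ; last first.
      by have : (e @^-1` N `|` Q) v by [right]; rewrite eNQ0.
    rewrite -subset0 => x Mx.
    have [_ [[u' Pu' <-] nNu']] : (e @` P) `&` ~` closure N !=set0.
      apply: (MP x Mx); apply: open_nbhs_nbhs; split.
        apply: closed_openC; exact: closed_closure.
      by move=> Nx; have : (M `&` closure N) x by []; rewrite sMN.2.
    have : (closure (e @` P) `|` B) (e u').
      by left; apply: subset_closure; exists u'.
    rewrite PBE => -[Mu'|Nu']; last by apply: nNu'; exact: subset_closure.
    by have : (e @^-1` M) u' by []; rewrite eM0.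
  have PBT : closure (e @` P) `|` B = [set: K].
    apply: irr => //; [|by left|by right].
    by apply: closedU => //; exact: closed_closure.
  have GP : ~` B `<=` closure (e @` P).
    by move=> x nBx; have [|//] : (closure (e @` P) `|` B) x by rewrite PBT.
  have AP : A `<=` closure (e @` P).
    by apply: closure_min => //; exact: closed_closure.
  have : (closure P `&` Q) v.
    split=> //; apply/embedding_closure/AP.
    by rewrite -[A _]/((e @^-1` A) v) APQ; right.
  by rewrite sPQ.1.
have : closure (e @` (e @^-1` A)) p by exact: GA.
rewrite AE image_setU closureU => -[]; first exact: (trace_side _ (E true)).
by apply: (trace_side _ (E false)) => //; [rewrite setUC|rewrite separatedC].
Qed.

Lemma irreducible_indecomposable : widely_connected W ->
  irreducible K -> indecomposable K.
Proof.
have [hK kK [einj econt eopen] dK] := eK.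
move=> [cW wide] [contK [p0 [q0 irr0]]]; split=> // A0 B0 pA0 pB0 AB0.
have [_ cK _] := contK.
have [A1 [B1 [p [q [irr [pA pB] AB A1p]]]]] : exists A1 B1 (p q : K),
    [/\ irreducible_between p q, proper_subcontinuum A1 /\
        proper_subcontinuum B1, A1 `|` B1 = [set: K] & A1 p].
  have [A0p|B0p] : (A0 `|` B0) p0 by rewrite AB0.
  - by exists A0, B0, p0, q0.
  - by exists B0, A0, p0, q0; split=> //; rewrite setUC.
have [[_ cA1 /(compact_closed hK) clA1] A1T] := pA.
have [[_ cB1 /(compact_closed hK) clB1] B1T] := pB.
have nA1q : ~ A1 q by move=> A1q; apply: A1T; exact: irr.
have B1q : B1 q by have [|//] : (A1 `|` B1) q by rewrite AB.
have nB1p : ~ B1 p by move=> B1p; apply: B1T; exact: irr.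
(* Shrinking the decomposition to [A] and [B] makes [~` B] dense in [A]. *)
pose B := closure (~` A1).
have BB1 : B `<=` B1.
  apply: closure_min => // x nA1x.
  by have [|//] : (A1 `|` B1) x by rewrite AB.
pose A := closure (~` B).
have AA1 : A `<=` A1.
  apply: closure_min => // x nBx.
  by apply: contrapT => nA1x; apply: nBx; exact: subset_closure.
have nBp : (~` B) p by move=> /BB1.
have clB : closed B by exact: closed_closure.
have cS : connected (e @^-1` A).
  apply: (connected_trace cW irr) => //.
  - by apply: connected_closure; exact: irreducible_setC_connected irr _ _ _.
  - exact: subset_closure.
  - exact: subset_closure.
have oA : open (~` A) by apply: closed_openC; exact: closed_closure.
have nAq : (~` A) q by move=> /AA1.
have [nd|deg] := pselect (Defs.nondegenerate (e @^-1` A)).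
  have [||z [nAz [w _ ew]]] := dK (~` A) => //; first by exists q.
  have [||w' [nAw' Aw']] := wide _ cS nd (e @^-1` (~` A)) => //.
  - by exists w; rewrite /= ew.
  - by move/continuousP: econt; apply.
(* Otherwise the trace of [~` B] is a single point, and so is the open set
   [~` B]; this point would be isolated in the connected space [K]. *)
have GA : ~` B `<=` A by exact: subset_closure.
have [||z [Gz [w _ ew]]] := dK (~` B); first by exists p.
  exact: closed_openC.
have Aw : A (e w) by rewrite ew; exact: GA.
have eSw : e @` (e @^-1` (~` B)) `<=` [set z].
  move=> _ [w' Gw' <-] /=; apply: contrapT => ww'; apply: deg.
  exists w, w'; split=> //; first exact: GA.
  by move=> E; apply: ww'; rewrite -ew E.
have Gz1 : ~` B `<=` [set z].
  have clz : closed [set z].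
    exact/accessible_closed_set1/hausdorff_accessible.
  apply: subset_trans (closure_min clz eSw).
  by apply: open_closure_trace; exact: closed_openC.
have GAE : ~` B = [set z] by apply/seteqP; split=> // _ ->.
have oB : open B.
  rewrite -[B]setCK GAE; apply: closed_openC.
  exact/accessible_closed_set1/hausdorff_accessible.
have sB : separated B (~` B) by apply/clopen_separatedP.
have [B0'|nB0] := connected_setT_separated cK sB (setUv B).
- by have : B q by [exact: subset_closure]; rewrite B0'.
- by have : (~` B) p by []; rewrite nB0.
Qed.

End Compactification.

Theorem mainTheorem6 (R : realType) (W : metricType R) (K : topologicalType)
    (e : W -> K) :
  separable_space W -> widely_connected W -> compactification e ->
  (indecomposable K <-> irreducible K).
Proof.
move=> sW wW eK; split; last exact: irreducible_indecomposable eK wW.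
have [hK _ _ _] := eK.
apply: indecomposable_irreducible => //.
by apply: compactification_pi_base eK _; exact: separable_pi_base.
Qed.
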